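(* (1) Let $B$ be a quadratic real division algebra of dimension at least four and let $T:B\to B$ be an invertible linear map. The isotope $B_T$ is power-commutative if and only if $T=\lambda S$ for some planar map $S:B\to B$ and some non-zero number $\lambda\in\mathbb{R}$. In this case, $1_B$ is an omnipresent idempotent in $B_T$. (2) Every power-commutative real division algebra with an omnipresent idempotent is a planar isotope of a quadratic real division algebra.
   Context: An algebra is a finite-dimensional real vector space with a bilinear multiplication (not necessarily associative, commutative or unital). A subalgebra is a linear subspace closed under multiplication. A division algebra is an algebra $A$ in which the maps $x\mapsto ax$ and $x\mapsto xa$ are bijective for every non-zero $a\in A$. An algebra is power-commutative if every subalgebra generated by a single element is commutative. An algebra $B$ is quadratic if it has an identity element $1_B$ and $1_B,x,x^2$ are linearly dependent for all $x\in B$. An omnipresent idempotent of an algebra $A$ is a non-zero idempotent contained in every two-dimensional subalgebra of $A$. For an algebra $B$ and an invertible linear map $T:B\to B$, the isotope $B_T$ is the vector space $B$ with multiplication $x\circ y=(Tx)(Ty)$. For a quadratic division algebra $B$, a linear map $T:B\to B$ is planar if it is invertible, $T(1_B)=1_B$, and every subalgebra of $B$ is invariant under $T$ (equivalently, $T$ is invertible, $T(1_B)=1_B$ and $T(x)\in\operatorname{span}\{1_B,x\}$ for all $x\in B$). If $T$ is planar, $B_T$ is called a planar isotope of $B$.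
   Formalization: The last sentence of (1) fails unless λ²=1 (e.g. quaternions, T=2·id, where 1∘1=4). It is replaced by: for T=λS with S planar and λ≠0, λ⁻²·1_B is an omnipresent idempotent of B_T, and 1_B itself is one if and only if λ²=1. *)

(* Defs.v *)
From HB Require Import structures.
From mathcomp Require Import all_boot all_order all_algebra.
From mathcomp Require Import reals.

Set Implicit Arguments.
Unset Strict Implicit.
Unset Printing Implicit Defensive.

Import GRing.Theory.
Local Open Scope ring_scope.

(* A (not necessarily associative, commutative or unital) algebra is a vectType
   V, hence finite-dimensional, with a product mul : {bilinear V -> V -> V}. *)

Section Algebras.
Variables (R : realType) (V : vectType R).
Implicit Types (mul : {bilinear V -> V -> V}) (U : {vspace V}) (T : 'End(V)).

Definition subalgebra mul U : Prop := {in U &, forall x y, mul x y \in U}.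

Definition division_algebra mul : Prop :=
  forall a : V, a != 0 -> bijective (mul a) /\ bijective (mul^~ a).

(* The subalgebra generated by a, as the intersection of all the subalgebras
   that contain a. *)
Definition generated mul (a : V) : V -> Prop :=
  fun x => forall U, subalgebra mul U -> a \in U -> x \in U.

Definition power_commutative mul : Prop :=
  forall a x y : V,
    generated mul a x -> generated mul a y -> mul x y = mul y x.

Definition identity_element mul (one : V) : Prop :=
  left_id one mul /\ right_id one mul.

Definition quadratic mul (one : V) : Prop :=
  identity_element mul one /\ forall x : V, ~~ free [:: one; x; mul x x].

Definition omnipresent_idempotent mul (e : V) : Prop :=
  [/\ e != 0, mul e e = e &
      forall U, subalgebra mul U -> \dim U = 2%N -> e \in U].

Definition planar mul (one : V) T : Prop :=
  [/\ bijective T, T one = one &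
      forall U, subalgebra mul U -> (T @: U <= U)%VS].

Definition isotope mul T (x y : V) : V := mul (T x) (T y).

Lemma isotope_bilinear mul T : bilinear_for *:%R *:%R (isotope mul T).
Proof.
split=> [y a x1 x2|x a y1 y2]; rewrite /isotope linearP.
  by rewrite linearPl.
by rewrite linearPr.
Qed.

HB.instance Definition _ mul T :=
  bilinear_isBilinear.Build R V V V *:%R *:%R (isotope mul T)
    (isotope_bilinear mul T).

End Algebras.

(* Main.v *)
(* (1) If [y = T x], then [x] commutes with [x o x] in [B_T] iff [y] commutes
   with [T (y^2)] in [B].  As the centralizer of a non-scalar [y] in a quadratic
   division algebra is [span(1, y)], imaginary [y] (with [y^2] scalar) give
   [T 1 \in span(1, y)], hence [T 1 = lam 1], and then [T y \in span(1, y)] for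
   all [y].

   (2) By Hopf's theorem (a commutative real division algebra has dimension at
   most 2) each element either has its square proportional to it or lies in a
   commutative plane that contains the idempotent [e].  The squares cannot be
   proportional throughout a plane, which forces [e] to commute with
   all [x] and [span(e, x)] to be a subalgebra; then [T] is the multiplication
   by [e] and [B] has the product [T^-1 x T^-1 y].

   Hopf's theorem: squaring is onto (minimise [|x^2 - a|]) and
   [x^2 = y^2] only for [x = y] or [x = - y].  In dimension at least 3, take a
   half turn [x_t] from [u] to [- u] in a plane and [r] outside this plane.  The
   homotopy [(1 - s)^2 x_t^2 - s^2 r^2] avoids 0 and contracts the loop [x_t^2]
   to a point, so lifting it through the squaring map makes the lift of a
   constant path change sign.  The lifting is carried out on a fine finite
   grid. *)

Require Import Defs.
From HB Require Import structures.
From mathcomp Require Import all_boot all_order all_algebra.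
From mathcomp Require Import boolp classical_sets reals topology normedtype.
From mathcomp Require Import derive.
From mathcomp Require Import ring lra.

Set Implicit Arguments.
Unset Strict Implicit.
Unset Printing Implicit Defensive.

Import Order.TTheory GRing.Theory Num.Theory.
Import numFieldNormedType.Exports.
Local Open Scope ring_scope.

(** * Identities for bilinear maps and squares *)

Section Bilinear.
Variables (R : comNzRingType) (U V W : lmodType R) (f : {bilinear U -> V -> W}).

Lemma bilDl x y z : f (x + y) z = f x z + f y z.
Proof. exact: linearDl. Qed.
Lemma bilDr x y z : f x (y + z) = f x y + f x z.
Proof. exact: linearD. Qed.
Lemma bilNl x y : f (- x) y = - f x y.
Proof. exact: linearNl. Qed.
Lemma bilNr x y : f x (- y) = - f x y.
Proof. exact: linearN. Qed.
Lemma bilZl a x y : f (a *: x) y = a *: f x y.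
Proof. exact: linearZl_LR. Qed.
Lemma bilZr a x y : f x (a *: y) = a *: f x y.
Proof. exact: linearZr_LR. Qed.
Lemma bil0l y : f 0 y = 0.
Proof. exact: linear0l. Qed.
Lemma bil0r x : f x 0 = 0.
Proof. exact: linear0. Qed.

Definition bilE := (bilDl, bilDr, bilNl, bilNr, bilZl, bilZr).

Lemma bil_suml I (s : seq I) (F : I -> U) y :
  f (\sum_(i <- s) F i) y = \sum_(i <- s) f (F i) y.
Proof. by elim/big_rec2: _ => [|i a b _ <-]; rewrite ?bil0l ?bilDl. Qed.
Lemma bil_sumr I (s : seq I) (F : I -> V) x :
  f x (\sum_(i <- s) F i) = \sum_(i <- s) f x (F i).
Proof. by elim/big_rec2: _ => [|i a b _ <-]; rewrite ?bil0r ?bilDr. Qed.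

End Bilinear.

Section Squares.
Variables (R : comNzRingType) (V W : lmodType R) (f : {bilinear V -> V -> W}).

Lemma subr_sqr_comm (x y : V) : f x y = f y x ->
  f x x - f y y = f (x - y) (x + y).
Proof. by move=> c; rewrite !bilE c addrA addrK. Qed.

Lemma sqrD_comm (x h : V) (t : R) : f x h = f h x ->
  f (x + t *: h) (x + t *: h) = f x x + (2 * t) *: f x h + t ^+ 2 *: f h h.
Proof.
move=> c; rewrite !bilE -c scalerA -expr2 !addrA; congr (_ + _).
by rewrite mulr_natl mulr2n scalerDl addrA.
Qed.

End Squares.

(** * A first-order condition for real polynomials *)

Section RealPolynomials.
Variable R : realType.

(** Near 0 the linear term dominates, so a non-zero [b] would give a negative value at some small
    [t]. This takes the place of derivatives in the extremal arguments below, where the functions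
    restricted to lines are polynomials of degree at most 4. *)
Lemma quartic_ge0_linear_coef (b c d e : R) :
    (forall t, 0 <= b * t + c * t ^+ 2 + d * t ^+ 3 + e * t ^+ 4) -> b = 0.
Proof.
move=> h; apply/eqP/negPn/negP=> b0.
have b2 : 0 < b ^+ 2 by rewrite exprn_even_gt0.
pose S := `|c| * b ^+ 2 + `|d| * `|b| ^+ 3 + `|e| * b ^+ 4.
have S0 : 0 <= S.
  have [c2 d3 e4] : [/\ 0 <= b ^+ 2, 0 <= `|b| ^+ 3 & 0 <= b ^+ 4].
    by split; [exact: sqr_ge0 | exact: exprn_ge0 | exact: exprn_even_ge0].
  by rewrite /S; apply: addr_ge0; [apply: addr_ge0|]; exact: mulr_ge0.
(* At [t = - u * b] with [0 < u <= 1] the sum is at most [- u * b ^+ 2 + u ^+ 2 * S]; this choice of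
   [u] ensures [u * S < b ^+ 2]. *)
pose u := b ^+ 2 / (S + b ^+ 2).
have Sb : 0 < S + b ^+ 2 by rewrite ltr_wpDl.
have u0 : 0 < u by rewrite divr_gt0.
have u1 : u <= 1 by rewrite ler_pdivrMr // mul1r lerDr.
have uS : u * (S + b ^+ 2) = b ^+ 2 by rewrite mulfVK // gt_eqF.
have uSb : u * S < b ^+ 2.
  by rewrite -uS (mulrDr u S) ltrDl mulr_gt0.
have := h (- u * b); rewrite leNgt => /negP; apply.
have h1 : c * (- u * b) ^+ 2 <= u ^+ 2 * (`|c| * b ^+ 2).
  rewrite exprMn sqrrN mulrCA ler_wpM2l ?exprn_even_ge0 //.
  by rewrite ler_wpM2r ?ler_norm // ltW.
have u32 : u ^+ 3 <= u ^+ 2.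
  by rewrite exprS ler_piMl // exprn_ge0 // ltW.
have u42 : u ^+ 4 <= u ^+ 2.
  by rewrite exprS (le_trans _ u32) // ler_piMl // exprn_ge0 // ltW.
have h2 : d * (- u * b) ^+ 3 <= u ^+ 2 * (`|d| * `|b| ^+ 3).
  rewrite (le_trans (ler_norm _)) // normrM normrX normrM normrN exprMn.
  rewrite (gtr0_norm u0) mulrCA ler_wpM2r // mulr_ge0 // exprn_ge0 //.
have h3 : e * (- u * b) ^+ 4 <= u ^+ 2 * (`|e| * b ^+ 4).
  rewrite (le_trans (ler_norm _)) // normrM normrX normrM normrN exprMn.
  rewrite (gtr0_norm u0) mulrCA -(normrX 4 b) (ger0_norm (x := b ^+ 4)).
    by rewrite ler_wpM2r // mulr_ge0 // exprn_even_ge0.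
  exact: exprn_even_ge0.
have : u ^+ 2 * S < u * b ^+ 2 by rewrite expr2 -mulrA ltr_pM2l.
rewrite /S mulrDr mulrDr; move: h1 h2 h3; rewrite -[in b * (_ * b)](mulrC b).
have -> : b * (b * - u) = - (u * b ^+ 2) by ring.
by move=> *; lra.
Qed.

End RealPolynomials.

(** * Extrema on spheres and balls of row vectors *)

Section RowVectors.
Local Open Scope classical_set_scope.
Local Open Scope ring_scope.
Variable R : realType.

Lemma bilinear_rV_continuous m n p
    (f : {bilinear 'rV[R]_m -> 'rV[R]_n -> 'rV[R]_p}) :
  continuous (fun z : 'rV[R]_m * 'rV[R]_n => f z.1 z.2).
Proof.
have -> : (fun z : 'rV[R]_m * 'rV[R]_n => f z.1 z.2) =
    fun z => \sum_i \sum_j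
      (z.1 0 i * z.2 0 j) *: f (delta_mx 0 i) (delta_mx 0 j).
  apply/funext => -[x y] /=.
  rewrite {1}(row_sum_delta x) bil_suml; apply: eq_bigr => i _.
  rewrite bilZl {1}(row_sum_delta y) bil_sumr scaler_sumr.
  by apply: eq_bigr => j _; rewrite bilZr scalerA.
apply: continuous_big => [|i _]; first exact: add_continuous.
apply: continuous_big => [|j _]; first exact: add_continuous.
move=> z; apply: cvgZr_tmp; apply: cvgM.
- apply: (@cvg_comp _ _ _ fst (fun x : 'rV[R]_m => x 0 i) _ (nbhs z.1)).
    exact: cvg_fst.
  exact: coord_continuous.
- apply: (@cvg_comp _ _ _ snd (fun x : 'rV[R]_n => x 0 j) _ (nbhs z.2)).
    exact: cvg_snd.
  exact: coord_continuous.
Qed.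

Lemma closed_ball_rV_compact n (r : R) :
  compact ([set x | `|x| <= r] : set 'rV[R]_n).
Proof.
apply: bounded_closed_compact.
  exists r; split=> [|s rs x /= xr]; first exact: num_real.
  by rewrite (le_trans xr) // ltW.
apply: (@preimage_closed _ _ (fun x : 'rV[R]_n => `|x|) [set y | y <= r]).
  by move=> x _; exact: norm_continuous.
exact: closed_le.
Qed.

Lemma sphere_rV_compact n : compact ([set x | `|x| = 1] : set 'rV[R]_n).
Proof.
apply: (subclosed_compact _ (@closed_ball_rV_compact n 1)).
  apply: (@preimage_closed _ _ (fun x : 'rV[R]_n => `|x|) [set y | y = 1]).
    by move=> x _; exact: norm_continuous.
  exact: closed_eq.
by move=> x /= ->.
Qed.

Lemma ball_EVT_min n (r : R) (f : 'rV[R]_n -> R) : 0 <= r -> continuous f ->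
  exists2 c, `|c| <= r & forall x, `|x| <= r -> f c <= f x.
Proof.
move=> r0 cf.
have [|c cA cm] := compact_EVT_min _ (@closed_ball_rV_compact n r)
    (continuous_subspaceT cf).
  by exists 0; rewrite /= normr0.
by exists c => [|x xr]; [rewrite inE in cA | apply: cm; rewrite inE].
Qed.

Lemma sphere_rV_neq0 n : exists x : 'rV[R]_n.+1, `|x| = 1.
Proof.
have e0 : delta_mx 0 0 != 0 :> 'rV[R]_n.+1.
  by apply/eqP => /rowP/(_ 0); rewrite !mxE eqxx /= => /eqP; rewrite oner_eq0.
exists (`|delta_mx 0 0 : 'rV[R]_n.+1|^-1 *: delta_mx 0 0) => /=.
by rewrite normrZ normfV normr_id mulVf // normr_eq0.
Qed.

Lemma sphere_EVT_max n (f : 'rV[R]_n.+1 -> R) :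
    {within [set x | `|x| = 1], continuous f} ->
  exists2 c, `|c| = 1 & forall x, `|x| = 1 -> f x <= f c.
Proof.
move=> cf.
have [c cA cm] :=
  compact_EVT_max (sphere_rV_neq0 n) (@sphere_rV_compact n.+1) cf.
by exists c => [|x xr]; [rewrite inE in cA | apply: cm; rewrite inE].
Qed.

(** The norm of [f] attains a minimum on the compact product of unit spheres, positive for lack of
    zero divisors; homogeneity does the rest. *)
Lemma bilinear_lower_bound n p
    (f : {bilinear 'rV[R]_n.+1 -> 'rV[R]_n.+1 -> 'rV[R]_p}) :
    (forall x y, f x y = 0 -> x = 0 \/ y = 0) ->
  exists2 c, 0 < c & forall x y, c * `|x| * `|y| <= `|f x y|.
Proof.
move=> f0; pose S := ([set x | `|x| = 1] : set 'rV[R]_n.+1).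
have [||[x0 y0] cA cm] := @compact_EVT_min _ R (fun z => `|f z.1 z.2|)
   (S `*` S) _
   (compact_setX (@sphere_rV_compact n.+1) (@sphere_rV_compact n.+1)).
- by have [x x1] := sphere_rV_neq0 n; exists (x, x).
- apply: continuous_subspaceT => z.
  apply: (@continuous_comp _ _ _ (fun z => f z.1 z.2) (fun x => `|x|)).
    exact: bilinear_rV_continuous.
  exact: norm_continuous.
move: cA; rewrite inE => -[/= x01 y01].
exists `|f x0 y0|.
  rewrite normr_gt0; apply/eqP => /f0[] z0; [move: x01 | move: y01];
    by rewrite /S /= z0 normr0 => /eqP; rewrite eq_sym oner_eq0.
move=> x y.
have [->|xn] := eqVneq x 0; first by rewrite normr0 mulr0 mul0r.
have [->|yn] := eqVneq y 0; first by rewrite normr0 mulr0.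
have := cm (`|x|^-1 *: x, `|y|^-1 *: y).
rewrite inE /= bilZl bilZr !normrZ !normfV !normr_id.
rewrite ler_pdivlMl ?normr_gt0 // ler_pdivlMl ?normr_gt0 //.
rewrite (mulrC `|f x0 y0|) (mulrC _ `|y|); apply.
by split; rewrite /S /= normrZ normfV normr_id mulVf // normr_eq0.
Qed.

(** The norm of row vectors is the maximum norm; the Euclidean product is used to get polynomial
    functions to optimise. *)
Definition dot n (x y : 'rV[R]_n) : R := \sum_i x 0 i * y 0 i.

End RowVectors.

Section Dot.
Variables (R : realType) (n : nat).
Implicit Types x y z : 'rV[R]_n.

Lemma dotC x y : dot x y = dot y x.
Proof. by apply: eq_bigr => i _; rewrite mulrC. Qed.

Lemma dotDl x y z : dot (x + y) z = dot x z + dot y z.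
Proof. by rewrite -big_split; apply: eq_bigr => i _; rewrite mxE mulrDl. Qed.

Lemma dotZl a x y : dot (a *: x) y = a * dot x y.
Proof. by rewrite mulr_sumr; apply: eq_bigr => i _; rewrite mxE mulrA. Qed.

Lemma dotDr x y z : dot x (y + z) = dot x y + dot x z.
Proof. by rewrite dotC dotDl !(dotC x). Qed.

Lemma dotZr a x y : dot x (a *: y) = a * dot x y.
Proof. by rewrite dotC dotZl dotC. Qed.

Lemma dotNl x y : dot (- x) y = - dot x y.
Proof. by rewrite -scaleN1r dotZl mulN1r. Qed.

Lemma dotNr x y : dot x (- y) = - dot x y.
Proof. by rewrite dotC dotNl dotC. Qed.

Definition dotE := (dotDl, dotDr, dotZl, dotZr, dotNl, dotNr).

Lemma norm_sqr_le_dot x : `|x| ^+ 2 <= dot x x.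
Proof.
have d0 : 0 <= dot x x by apply: sumr_ge0 => i _; exact: sqr_ge0.
have [->|x0] := eqVneq `|x| 0; first by rewrite expr0n.
have [[i j] /= xij] := mx_norm_neq0 x0; rewrite [`|x|]xij.
rewrite (ord1 i) real_normK ?num_real // /dot (bigD1 j) //= expr2 lerDl.
by apply: sumr_ge0 => k _; exact: sqr_ge0.
Qed.

Lemma dot_eq0 x : dot x x = 0 -> x = 0.
Proof.
move=> x0; apply/eqP; rewrite -normr_eq0 -sqrf_eq0 eq_le sqr_ge0 andbT -x0.
exact: norm_sqr_le_dot.
Qed.

Lemma dot_continuous (T : topologicalType) (f g : T -> 'rV[R]_n) :
  continuous f -> continuous g -> continuous (fun t => dot (f t) (g t)).
Proof.
move=> cf cg; apply: continuous_big => [|i _]; first exact: add_continuous.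
move=> z; apply: cvgM.
- apply: (@cvg_comp _ _ _ f (fun x : 'rV[R]_n => x 0 i) _ (nbhs (f z))).
    exact: cf.
  exact: coord_continuous.
- apply: (@cvg_comp _ _ _ g (fun x : 'rV[R]_n => x 0 i) _ (nbhs (g z))).
    exact: cg.
  exact: coord_continuous.
Qed.

Lemma sqr_continuous (f : {bilinear 'rV[R]_n -> 'rV[R]_n -> 'rV[R]_n}) :
  continuous (fun x => f x x).
Proof.
move=> x.
have dx : ((fun y : 'rV[R]_n => (y, y)) @ x --> (x, x))%classic.
  by apply: (@cvg_pair _ _ _ (nbhs x) (nbhs x) (nbhs x)); exact: cvg_id.
exact: (cvg_comp _ _ dx (@bilinear_rV_continuous _ _ _ _ f (x, x))).
Qed.

End Dot.

(** * Surjectivity of squaring *)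

Section SquareRoots.
Variables (R : realType) (n : nat).
Let E := 'rV[R]_n.+2.
Variable mu : {bilinear E -> E -> E}.
Hypothesis muC : commutative mu.
Hypothesis mu_eq0 : forall x y, mu x y = 0 -> x = 0 \/ y = 0.

Lemma mu_surj (x y : E) : x != 0 -> exists h, mu x h = y.
Proof.
move=> x0; pose A := lin1_mx (mu x).
have Au : A \in unitmx.
  rewrite -row_free_unit -kermx_eq0; apply/rowV0P => v /sub_kermxP.
  by rewrite mul_rV_lin1 => /mu_eq0[/eqP|//]; rewrite (negPf x0).
by exists (y *m invmx A); rewrite -[mu x _]mul_rV_lin1 mulmxKV.
Qed.

(** Otherwise [- dot (mu y y) b] is positive definite. Take [k] off the line of [b] and maximise the
    quotient of [dot (mu y y) k] by this form. At a maximum [x0] with value [M], the first variation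
    makes [M *: b + k] orthogonal to the range of [mu x0], which is the whole space; hence
    [k = - M *: b], a contradiction. *)
Lemma sqr_pos_dot (b : E) : b != 0 -> exists y, 0 < dot (mu y y) b.
Proof.
move=> b0; apply/not_existsP => H.
have D0 y : 0 <= - dot (mu y y) b by rewrite oppr_ge0 leNgt; apply/negP.
(* A zero at [x != 0] would be a minimum, but the first variation along [h] with [mu x h = b] is
   [- 2 * dot b b]. *)
have Dpos x : x != 0 -> 0 < - dot (mu x x) b.
  move=> x0; rewrite lt_neqAle D0 andbT eq_sym; apply/negP => /eqP Dx.
  have [h xh] := mu_surj b x0.
  have /eqP : - 2 * dot b b = 0.
    apply: (@quartic_ge0_linear_coef _ _ (- dot (mu h h) b) 0 0) => t.
    have := D0 (x + t *: h).
    by rewrite sqrD_comm // xh !dotE !opprD Dx => ?; lra.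
  rewrite mulf_eq0 oppr_eq0 pnatr_eq0 /= => /eqP/dot_eq0/eqP.
  exact/negP.
have [k kb] : exists k : E, forall l, k <> l *: b.
  have [b00|b00] := eqVneq (b 0 0) 0.
    exists (delta_mx 0 0) => l /rowP/(_ 0); rewrite !mxE b00 mulr0 eqxx /=.
    by move/eqP; rewrite oner_eq0.
  exists (delta_mx 0 1) => l /rowP kl.
  have := kl 0; rewrite !mxE eqxx /= => /esym/eqP.
  rewrite mulf_eq0 (negPf b00) orbF => /eqP l0.
  have := kl 1; rewrite !mxE eqxx l0 mul0r /= => /eqP.
  by rewrite oner_eq0.
pose D (y : E) := - dot (mu y y) b; pose N (y : E) := dot (mu y y) k.
have cN : continuous N.
  by apply: dot_continuous; [exact: sqr_continuous | exact: cst_continuous].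
have cD : continuous D.
  have cb : continuous (fun y : E => dot (mu y y) b).
    by apply: dot_continuous; [exact: sqr_continuous | exact: cst_continuous].
  by move=> y; exact: cvgN (cb y).
have nz (x : E) : `|x| = 1 -> x != 0.
  by move=> x1; rewrite -normr_eq0 x1 oner_eq0.
have [|x0 x01 x0max] := @sphere_EVT_max R n.+1 (fun y => N y / D y).
  apply: continuous_in_subspaceT => x; rewrite inE => x1.
  have Dx0 : D x != 0 by rewrite gt_eqF // Dpos // nz.
  exact: (cvgM (cN x) (cvgV Dx0 (cD x))).
pose M := N x0 / D x0.
have NM y : N y <= M * D y.
  have [->|y0] := eqVneq y 0.
    by rewrite /N /D !bil0l -(scale0r 0) !dotE; lra.
  have := x0max (`|y|^-1 *: y).
  rewrite normrZ normfV normr_id mulVf ?normr_eq0 // => /(_ erefl).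
  have Ns (s : R) : N (s *: y) = s ^+ 2 * N y.
    by rewrite /N (bilZl mu) (bilZr mu) scalerA -expr2 dotZl.
  have Ds (s : R) : D (s *: y) = s ^+ 2 * D y.
    by rewrite /D (bilZl mu) (bilZr mu) scalerA -expr2 dotZl mulrN.
  rewrite -/M Ns Ds -mulf_div divff ?expf_neq0 ?invr_eq0 ?normr_eq0 // mul1r.
  by rewrite ler_pdivrMr // Dpos.
have x00 : x0 != 0 by exact: nz.
have N0 : N x0 = M * D x0 by rewrite /M mulfVK // gt_eqF // Dpos.
have [h xh] := mu_surj (M *: b + k) x00.
apply: (kb (- M)); apply/eqP; rewrite scaleNr -addr_eq0 addrC; apply/eqP.
apply: dot_eq0.
have : - 2 * dot (M *: b + k) (M *: b + k) = 0.
  apply: (@quartic_ge0_linear_coef _ _ (M * D h - N h) 0 0) => t.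
  have := NM (x0 + t *: h); move: N0; rewrite /N /D.
  rewrite sqrD_comm // xh -subr_ge0 => N0 /le_trans; apply.
  move: N0; rewrite !dotE => N0; rewrite (dotC k b).
  by lra.
by lra.
Qed.

(** At a minimum [x != 0] of the squared Euclidean distance from [mu x x] to [a], the variation
    along [h] with [mu x h = mu x x - a] forces this vector to vanish. For [a != 0] the minimum is
    not at 0, as [sqr_pos_dot] supplies a direction of descent. *)
Lemma sqr_surj (a : E) : exists y, mu y y = a.
Proof.
have [->|a0] := eqVneq a 0; first by exists 0; rewrite bil0l.
have [c c0 cP] := bilinear_lower_bound mu_eq0.
pose f (x : E) := dot (mu x x - a) (mu x x - a).
have cf : continuous f.
  have cs : continuous (fun x : E => mu x x - a).
    by move=> x; exact: (cvgB (@sqr_continuous _ _ mu x) (cvg_cst a)).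
  exact: dot_continuous.
have daa : 0 <= dot a a by exact: le_trans (sqr_ge0 _) (norm_sqr_le_dot a).
have aN := normr_ge0 a.
(* Beyond the radius [r >= 1], the bound [cP] puts [mu y y] at distance at least [dot a a + 1] from
   [a], so that [f y] exceeds [f 0]. *)
pose r := (`|a| + dot a a + 1) / c + 1.
have r1 : 1 <= r by rewrite lerDr divr_ge0 // ?ltW //; lra.
have r0 : 0 <= r by lra.
have [x xr xmin] := ball_EVT_min r0 cf.
have f0 : f 0 = dot a a by rewrite /f bil0l sub0r !dotE opprK.
have {xr}xmin y : f x <= f y.
  have [/xmin//|ry] := leP `|y| r.
  have := xmin 0; rewrite normr0 => /(_ r0) /le_trans; apply; rewrite f0.
  apply: le_trans (norm_sqr_le_dot _).
  have cr : `|a| + dot a a + 1 <= c * `|y| * `|y|.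
    have h1 : c * (r - 1) = `|a| + dot a a + 1.
      by rewrite /r addrK mulrC mulfVK // gt_eqF.
    rewrite -h1 -mulrA ler_pM2l //; nra.
  have h2 : dot a a + 1 <= `|mu y y - a|.
    have := lerB_dist (mu y y) a; have := cP y y; lra.
  by nra.
have [x0|x0] := eqVneq x 0.
  have [y Q0] := sqr_pos_dot a0; exfalso.
  pose P := dot (mu y y) (mu y y).
  have P0 : 0 <= P by exact: le_trans (sqr_ge0 _) (norm_sqr_le_dot _).
  (* With [Q = dot (mu y y) a], the value of [f] at [Num.sqrt s *: y] is
     [f 0 - 2 * s * Q + s ^+ 2 * P], which is below [f 0] because [s * P < Q]. *)
  pose s := dot (mu y y) a / (P + 1).
  have s0 : 0 < s by rewrite divr_gt0 //; lra.
  have sP : s * (P + 1) = dot (mu y y) a by rewrite mulfVK // gt_eqF //; lra.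
  have := xmin (Num.sqrt s *: y).
  rewrite x0 f0 /f (bilZl mu) (bilZr mu) scalerA -expr2.
  by rewrite (sqr_sqrtr (ltW s0)) !dotE (dotC a) -/P; nra.
have [z Ez] : exists z, z = mu x x - a by eexists.
exists x; apply/eqP; rewrite -subr_eq0 -Ez; apply/eqP; apply: dot_eq0.
have [h xh] := mu_surj z x0.
have : 4 * dot z z = 0.
  apply: (@quartic_ge0_linear_coef _ _ (4 * dot z z + 2 * dot z (mu h h))
    (4 * dot z (mu h h)) (dot (mu h h) (mu h h))) => t.
  have zt : mu (x + t *: h) (x + t *: h) - a =
      z + (2 * t) *: z + t ^+ 2 *: mu h h.
    by rewrite sqrD_comm // xh Ez addrAC [X in X + _]addrAC.
  have := xmin (x + t *: h).
  rewrite /f zt -Ez -subr_ge0 !dotE (dotC (mu h h) z) => /le_trans; apply.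
  by rewrite le_eqVlt; apply/orP; left; apply/eqP; ring.
by lra.
Qed.

End SquareRoots.

(** * Lifting a homotopy through the squaring map *)

Section Monodromy.
Variables (R : realType) (E : normedModType R) (sq : E -> E).
Variables (N : nat) (a : nat -> nat -> E) (e : R).
Hypothesis sq_surj : forall b, exists x, sq x = b.
Hypothesis sqN : forall x, sq (- x) = sq x.
Hypothesis sq_inj : forall x y, sq x = sq y -> x = y \/ x = - y.
Hypothesis near_h : forall i j x y, (i < N)%N -> (j <= N)%N ->
  sq x = a i j -> sq y = a i.+1 j -> `|x - y| < e \/ `|x + y| < e.
Hypothesis near_v : forall i j x y, (i <= N)%N -> (j < N)%N ->
  sq x = a i j -> sq y = a i j.+1 -> `|x - y| < e \/ `|x + y| < e.
Hypothesis root_ge : forall i j x, (i <= N)%N -> (j <= N)%N ->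
  sq x = a i j -> 2 * e <= `|x|.
Hypothesis a_loop : forall j, (j <= N)%N -> a N j = a 0%N j.

(** Discrete monodromy: since roots have norm at least [2 * e], steps below [e] tell a root from its
    opposite, and the chain behaves like a continuous lift of a loop that changes sign. *)
Definition odd_lift j := exists y : nat -> E,
  [/\ forall i, (i <= N)%N -> sq (y i) = a i j,
      forall i, (i < N)%N -> `|y i - y i.+1| < e &
      y N = - y 0%N].

Let norm2 (x y : E) : 2 * `|x| <= `|x + y| + `|x - y|.
Proof.
rewrite -[2 * _]ger0_norm ?mulr_ge0 // normrM normr_id -normrZ.
rewrite scaler_nat mulr2n.
by apply: le_trans (ler_normD _ _); rewrite addrACA subrr addr0.
Qed.

(** Each root moves to the nearby root [z] over the next row. If consecutive new roots were close
    only up to sign, their sum would be below [e] and their difference below [3 * e], against norms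
    of at least [2 * e]. Likewise [z N = z 0] would be near both [y 0] and [- y 0]. *)
Lemma odd_lift_step j : (j < N)%N -> odd_lift j -> odd_lift j.+1.
Proof.
move=> jN [y [ya yc yN]].
have /choice[z zP] : forall i, exists z, (i <= N)%N ->
    sq z = a i j.+1 /\ `|y i - z| < e.
  move=> i.
  case: (leqP i N) => [iN|_]; last by exists 0.
  have [x xa] := sq_surj (a i j.+1).
  have [?|yx] := near_v iN jN (ya _ iN) xa; first by exists x.
  by exists (- x); rewrite sqN opprK.
exists z; split=> [i /zP[]//|i iN|].
  have [za zy] := zP _ (ltnW iN); have [zSa zSy] := zP _ iN.
  have [//|zz] := near_h iN jN za zSa.
  have := root_ge (ltnW iN) jN za; have := norm2 (z i) (z i.+1).
  have : `|z i - z i.+1| < 3 * e.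
    have -> : z i - z i.+1 = (z i - y i) + (y i - y i.+1) + (y i.+1 - z i.+1).
      by rewrite !addrA subrK subrK.
    rewrite (le_lt_trans (ler_normD _ _)) //.
    rewrite (le_lt_trans (lerD (ler_normD _ _) (lexx _))) //.
    by have := yc _ iN; rewrite distrC in zy; lra.
  by move=> *; suff: e < e by [rewrite ltxx]; lra.
have [z0a zy0] := zP _ (leq0n N); have [zNa zyN] := zP _ (leqnn N).
have [zz|//] : z N = z 0%N \/ z N = - z 0%N.
  by apply: sq_inj; rewrite zNa z0a a_loop.
have := root_ge (leq0n N) jN z0a; have := norm2 (z 0%N) (y 0%N).
move: zyN; rewrite yN zz -opprD normrN addrC => *.
rewrite (distrC (y 0%N)) in zy0; have z00 := normr_ge0 (z 0%N).
suff: e < e by rewrite ltxx.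
by lra.
Qed.

Lemma odd_lift_last : odd_lift 0 -> odd_lift N.
Proof.
move=> h; have : forall j, (j <= N)%N -> odd_lift j.
  by elim=> // j IH jN; apply: odd_lift_step => //; exact: IH (ltnW jN).
by apply.
Qed.

(* A constant loop lifts to constant chains only, which are not odd. *)
Lemma not_odd_lift0 : 0 < e -> (forall i, (i <= N)%N -> a i N = a 0%N N) ->
  ~ odd_lift 0.
Proof.
move=> e0 ac /odd_lift_last[y [ya yc yN]].
have yconst i : (i <= N)%N -> y i = y 0%N.
  elim: i => // i IH iN; rewrite -(IH (ltnW iN)).
  have [//|ee] : y i.+1 = y i \/ y i.+1 = - y i.
    by apply: sq_inj; rewrite !ya // ?ac // ltnW.
  have := yc _ iN; rewrite ee opprK => yy.
  have := root_ge (ltnW iN) (leqnn N) (ya _ (ltnW iN)).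
  have := norm2 (y i) (y i); rewrite subrr normr0.
  by move=> *; suff: e < e by [rewrite ltxx]; lra.
move: yN; rewrite yconst // => /eqP; rewrite -addr_eq0 -mulr2n -scaler_nat.
rewrite scaler_eq0 pnatr_eq0 /= => /eqP y00.
have := root_ge (leq0n N) (leqnn N) (ya _ (leq0n N)).
by rewrite y00 normr0; lra.
Qed.

End Monodromy.

(** * A contractible loop of squares in dimension at least three *)

Lemma coord_le_norm (R : realType) n (x : 'rV[R]_n) i : `|x 0 i| <= `|x|.
Proof.
rewrite [leRHS]/Num.norm /= mx_normrE; apply/bigmax_geP; right => /=.
by exists (0, i).
Qed.

Lemma norm_delta_le1 (R : realType) n (i : 'I_n) :
  `|delta_mx 0 i : 'rV[R]_n| <= 1.
Proof.
set x := delta_mx 0 i; have [x0|x0] := eqVneq `|x| 0; first by rewrite x0 ler01.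
have [[k j] /= xij] := mx_norm_neq0 x0; rewrite [`|x|]xij mxE.
by case: (_ && _); rewrite ?normr1 ?normr0 ?ler01.
Qed.

(* The half turn [arc] joins [e0] to [- e0] inside the plane of [e0] and [e1],
   while [e2] lies outside that plane. *)
Section HalfTurn.
Variables (R : realType) (n : nat).

Definition e0 : 'rV[R]_n.+3 := delta_mx 0 0.
Definition e1 : 'rV[R]_n.+3 := delta_mx 0 (inord 1).
Definition e2 : 'rV[R]_n.+3 := delta_mx 0 (inord 2).

Definition arc (t : R) := (1 - 2 * t) *: e0 + (t * (1 - t)) *: e1.
(** As [s] runs from 0 to 1, the half turn shrinks to 0 while [apex] leaves its plane, so that
    neither their sum nor their difference vanishes. *)
Definition cone (t s : R) := (1 - s) *: arc t.
Definition apex (s : R) := s *: e2.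

Lemma arc0 : arc 0 = e0.
Proof. by rewrite /arc mulr0 subr0 mul0r scale0r addr0 scale1r. Qed.

Lemma arc1 : arc 1 = - e0.
Proof. by apply/rowP => i; rewrite !mxE; ring. Qed.

Lemma arc_le t : 0 <= t <= 1 -> `|arc t| <= 2.
Proof.
move=> t01; rewrite (le_trans (ler_normD _ _)) // (normrZ _ e0) (normrZ _ e1).
have h1 : `|1 - 2 * t| <= 1 by rewrite ler_norml; lra.
have h2 : `|t * (1 - t)| <= 1 by rewrite ler_norml; nra.
have := ler_pM (normr_ge0 _) (normr_ge0 _) h1 (norm_delta_le1 _ _ : `|e0| <= 1).
have := ler_pM (normr_ge0 _) (normr_ge0 _) h2 (norm_delta_le1 _ _ : `|e1| <= 1).
by lra.
Qed.

Lemma arc_lip t d : 0 <= t -> 0 <= d -> t + d <= 1 ->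
  `|arc t - arc (t + d)| <= 3 * d.
Proof.
move=> t0 d0 td.
have -> : arc t - arc (t + d) = (2 * d) *: e0 + (d * (2 * t + d - 1)) *: e1.
  by apply/rowP => i; rewrite !mxE; ring.
rewrite (le_trans (ler_normD _ _)) // (normrZ _ e0) (normrZ _ e1).
have h1 : `|2 * d| <= 2 * d by rewrite ger0_norm; lra.
have h2 : `|d * (2 * t + d - 1)| <= d by rewrite ler_norml; nra.
have := ler_pM (normr_ge0 _) (normr_ge0 _) h1 (norm_delta_le1 _ _ : `|e0| <= 1).
have := ler_pM (normr_ge0 _) (normr_ge0 _) h2 (norm_delta_le1 _ _ : `|e1| <= 1).
by lra.
Qed.

Lemma cone_le t s : 0 <= t <= 1 -> 0 <= s <= 1 -> `|cone t s| <= 2.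
Proof.
move=> t01 s01; rewrite normrZ ger0_norm; last lra.
by have := arc_le t01; have := normr_ge0 (arc t); nra.
Qed.

Lemma apex_le s : 0 <= s <= 1 -> `|apex s| <= 1.
Proof.
move=> s01; rewrite normrZ ger0_norm; last lra.
by have := (norm_delta_le1 _ _ : `|e2| <= 1); have := normr_ge0 e2; nra.
Qed.

Lemma apex_lip s s' d : `|s - s'| <= d -> `|apex s - apex s'| <= d.
Proof.
move=> ss; rewrite /apex -scalerBl normrZ.
have := (norm_delta_le1 _ _ : `|e2| <= 1); have := normr_ge0 e2.
by have := normr_ge0 (s - s'); nra.
Qed.

Lemma cone_lip_arc t s d : 0 <= t -> 0 <= d -> t + d <= 1 -> 0 <= s <= 1 ->
  `|cone t s - cone (t + d) s| <= 3 * d.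
Proof.
move=> t0 d0 td s01; rewrite /cone -scalerBr normrZ ger0_norm; last lra.
by have := arc_lip t0 d0 td; have := normr_ge0 (arc t - arc (t + d)); nra.
Qed.

Lemma cone_lip_height t s d : 0 <= t <= 1 -> 0 <= d ->
  `|cone t s - cone t (s + d)| <= 3 * d.
Proof.
move=> t01 d0; rewrite /cone -scalerBl normrZ.
have -> : 1 - s - (1 - (s + d)) = d by ring.
by rewrite ger0_norm //; have := arc_le t01; nra.
Qed.

(** A single large coordinate suffices for the maximum norm: that of [e2] if [s >= 1 / 2], that of
    [e0] if [1 - 2 * t] has absolute value at least [1 / 2], and otherwise that of [e1], as then
    [t * (1 - t) >= 3 / 16]. The two signs serve the two factors of a difference of squares. *)
Lemma cone_apex_ge t s (b : bool) : 0 <= t <= 1 -> 0 <= s <= 1 ->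
  1 / 16 <= `|cone t s + (-1) ^+ b *: apex s|.
Proof.
have i01 : (0 == inord 1 :> 'I_n.+3) = false by rewrite -val_eqE /= inordK.
have i02 : (0 == inord 2 :> 'I_n.+3) = false by rewrite -val_eqE /= inordK.
have i12 : (inord 1 == inord 2 :> 'I_n.+3) = false.
  by rewrite -val_eqE /= !inordK.
move=> t01 s01; have [s2|s2] := leP (1 / 2) s.
  apply: le_trans (coord_le_norm _ (inord 2)).
  rewrite !mxE /= ![inord 2 == _]eq_sym i02 i12 eqxx /= !(mulr0, addr0, add0r).
  by rewrite mulr1 normrMsign ger0_norm; lra.
have [t2|t2] := leP (1 / 2) `|1 - 2 * t|.
  apply: le_trans (coord_le_norm _ 0).
  rewrite !mxE /= i01 i02 !(mulr0, addr0, mulr1) normrM ger0_norm; last lra.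
  by nra.
apply: le_trans (coord_le_norm _ (inord 1)).
rewrite !mxE /= [inord 1 == 0]eq_sym i01 eqxx i12.
rewrite /= !(mulr0, addr0, add0r, mulr1).
move: t2; rewrite ltr_norml => t2.
have tt : 3 / 16 <= t * (1 - t) by nra.
by rewrite ger0_norm; nra.
Qed.

End HalfTurn.

Section Homotopy.
Variables (R : realType) (n : nat).
Variable mu : {bilinear 'rV[R]_n.+3 -> 'rV[R]_n.+3 -> 'rV[R]_n.+3}.
Hypothesis muC : commutative mu.
Variables (c K : R).
Hypothesis cP : forall x y, c * `|x| * `|y| <= `|mu x y|.
Hypothesis KP : forall x y, `|mu x y| <= K * `|x| * `|y|.
Hypotheses (c0 : 0 < c) (K0 : 0 < K).

Definition homotopy (t s : R) :=
  mu (cone n t s) (cone n t s) - mu (apex n s) (apex n s).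

Lemma homotopy_ge t s : 0 <= t <= 1 -> 0 <= s <= 1 ->
  c / 256 <= `|homotopy t s|.
Proof.
move=> t01 s01; rewrite /homotopy subr_sqr_comm // (le_trans _ (cP _ _)) //.
have := cone_apex_ge n true t01 s01; have := cone_apex_ge n false t01 s01.
rewrite expr0 expr1 scale1r scaleN1r -mulrA => h1 h2.
rewrite ler_pM2l //.
have -> : 256^-1 = (1 / 16) * (1 / 16) :> R by field.
by apply: ler_pM => //; lra.
Qed.

(** By differences of squares, the cones contribute [3 * d] times at most 4 and the apexes [d] times
    at most 2, hence the factor 14. *)
Lemma homotopy_lip t s t' s' d :
    0 <= t <= 1 -> 0 <= s <= 1 -> 0 <= t' <= 1 -> 0 <= s' <= 1 ->
    `|cone n t s - cone n t' s'| <= 3 * d -> `|s - s'| <= d ->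
  `|homotopy t s - homotopy t' s'| <= 14 * K * d.
Proof.
move=> t01 s01 t01' s01' ww ss.
have -> : homotopy t s - homotopy t' s' =
    mu (cone n t s - cone n t' s') (cone n t s + cone n t' s')
    - mu (apex n s - apex n s') (apex n s + apex n s').
  by rewrite -!subr_sqr_comm // /homotopy opprD addrACA -opprD.
rewrite (le_trans (ler_normB _ _)) //.
have -> : 14 * K * d = K * (3 * d) * 4 + K * d * 2 by ring.
apply: lerD.
  apply: le_trans (KP _ _) _; apply: ler_pM => //.
  - by rewrite mulr_ge0 // ltW.
  - by rewrite ler_wpM2l // ltW.
  - rewrite (le_trans (ler_normD _ _)) //.
    have -> : 4 = 2 + 2 :> R by ring.
    exact: lerD (cone_le n t01 s01) (cone_le n t01' s01').
apply: le_trans (KP _ _) _; apply: ler_pM => //.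
- by rewrite mulr_ge0 // ltW.
- by rewrite ler_wpM2l ?apex_lip // ltW.
- rewrite (le_trans (ler_normD _ _)) //.
  exact: lerD (apex_le n s01) (apex_le n s01').
Qed.

(** The difference of the squares is [mu (x - y) (x + y)], of norm at least [c * e ^+ 2] when both
    factors have norm at least [e]. *)
Lemma sqrt_dichotomy x y e : 0 <= e -> `|mu x x - mu y y| < c * e ^+ 2 ->
  `|x - y| < e \/ `|x + y| < e.
Proof.
move=> epos; rewrite subr_sqr_comm // => xy.
have [|l1] := ltP `|x - y| e; first by left.
have [|l2] := ltP `|x + y| e; first by right.
suff : `|mu (x - y) (x + y)| < `|mu (x - y) (x + y)| by rewrite ltxx.
apply: lt_le_trans xy _; rewrite (le_trans _ (cP _ _)) //.
by rewrite expr2 -mulrA ler_pM2l // ler_pM.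
Qed.

Lemma root_norm_ge x b e : 0 <= e -> 1024 * K * e ^+ 2 = c ->
  mu x x = b -> c / 256 <= `|b| -> 2 * e <= `|x|.
Proof.
move=> e0 eK <- h; rewrite leNgt; apply/negP => xe; move: h.
apply/negP; rewrite -ltNge (le_lt_trans (KP _ _)) //.
have -> : c / 256 = K * ((2 * e) * (2 * e)) by rewrite -eK; field.
by rewrite -mulrA ltr_pM2l // ltr_pM.
Qed.

End Homotopy.

Theorem no_commutative_division_rV (R : realType) n
    (mu : {bilinear 'rV[R]_n.+3 -> 'rV[R]_n.+3 -> 'rV[R]_n.+3}) :
    commutative mu -> (forall x y, mu x y = 0 -> x = 0 \/ y = 0) ->
  False.
Proof.
move=> muC mu0.
have [c c0 cP] := bilinear_lower_bound mu0.
have [K K0 KP] := bilinear_schwarz (bilinear_rV_continuous (f := mu)).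
(* Here 1024 is [4 * 256]: a root of norm below [2 * e] would have a square of norm below
   [4 * K * e ^+ 2 = c / 256], the lower bound of the homotopy. *)
have [e epos eK] : exists2 e, 0 < e & 1024 * K * e ^+ 2 = c.
  have cK : 0 < c / (1024 * K) by rewrite divr_gt0 // mulr_gt0.
  exists (Num.sqrt (c / (1024 * K))); first by rewrite sqrtr_gt0.
  by rewrite sqr_sqrtr ?ltW // mulrC mulfVK // gt_eqF // mulr_gt0.
(* The first bound on the mesh keeps the steps of the half turn below [e]; the second makes
   neighbouring grid values close enough for [sqrt_dichotomy]. *)
have [k dk] : exists k, k.+1%:R^-1 < Num.min (e / 3) (c * e ^+ 2 / (14 * K)).
  have h : 0 < Num.min (e / 3) (c * e ^+ 2 / (14 * K)).
    by rewrite lt_min !divr_gt0 // ?mulr_gt0 // exprn_gt0.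
  by have [k] := ltr_add_invr h; rewrite add0r; exists k.
move: dk; set d := k.+1%:R^-1; rewrite lt_min => /andP[d3 d14].
have dpos : 0 < d by rewrite invr_gt0.
have {}d3 : 3 * d < e by rewrite mulrC -ltr_pdivlMr.
have {}d14 : 14 * K * d < c * e ^+ 2.
  by move: d14; rewrite ltr_pdivlMr ?mulr_gt0 // mulrC.
pose g (i : nat) := i%:R * d.
have gS i : g i.+1 = g i + d by rewrite /g -addn1 natrD mulrDl mul1r.
have gN : g k.+1 = 1 by rewrite /g mulfV // pnatr_eq0.
have g0 : g 0%N = 0 by rewrite /g mul0r.
have g01 i : (i <= k.+1)%N -> 0 <= g i <= 1.
  move=> iN; rewrite -gN /g mulr_ge0 ?ler0n ?(ltW dpos) //=.
  by rewrite ler_wpM2r ?(ltW dpos) // ler_nat.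
have gS1 i : (i < k.+1)%N -> 0 <= g i /\ g i + d <= 1.
  by move=> iN; have /andP[? _] := g01 _ (ltnW iN);
    have := g01 _ iN; rewrite gS => /andP[].
pose a i j := homotopy mu (g i) (g j).
apply: (@not_odd_lift0 R _ (fun x => mu x x) k.+1 a e) => //.
- exact: (sqr_surj muC mu0).
- by move=> u; rewrite bilNl bilNr opprK.
- move=> u v /eqP; rewrite -subr_eq0 subr_sqr_comm // => /eqP/mu0[] /eqP.
    by rewrite subr_eq0 => /eqP; left.
  by rewrite addr_eq0 => /eqP; right.
- move=> i j u v iN jN /= ua va; apply: (sqrt_dichotomy muC cP c0 (ltW epos)).
  rewrite ua va; apply: le_lt_trans d14.
  apply: (homotopy_lip muC KP K0); rewrite ?g01 // ?(ltnW iN) //.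
    by rewrite gS; have [? ?] := gS1 _ iN; rewrite cone_lip_arc ?g01 // ltW.
  by rewrite subrr normr0 ltW.
- move=> i j u v iN jN /= ua va; apply: (sqrt_dichotomy muC cP c0 (ltW epos)).
  rewrite ua va; apply: le_lt_trans d14.
  apply: (homotopy_lip muC KP K0); rewrite ?g01 // ?(ltnW jN) //.
    by rewrite gS cone_lip_height ?g01 // ltW.
  by rewrite gS opprD addrA subrr add0r normrN gtr0_norm.
- move=> i j u iN jN /= ua; apply: (root_norm_ge KP K0 (ltW epos) eK ua).
  by apply: (homotopy_ge muC cP c0); exact: g01.
- move=> j jN; rewrite /a gN g0 /homotopy /cone arc1 arc0.
  by rewrite scalerN bilNl bilNr opprK.
- move=> i iN; rewrite /a gN /homotopy; congr (_ - _).
  by rewrite /cone subrr !scale0r !bil0l.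
(* The row [s = 0] consists of the squares of the half turn, which is itself the odd lift. *)
- exists (fun i => arc n (g i)); split=> [i iN|i iN|].
  + by rewrite /a g0 /homotopy /cone /apex subr0 scale1r scale0r bil0l subr0.
  + have [gi gSi] := gS1 _ iN; rewrite gS.
    exact: le_lt_trans (arc_lip _ gi (ltW dpos) gSi) d3.
  + by rewrite gN g0 arc0 arc1.
Qed.

(** * Hopf's theorem for subalgebras *)

Section Transport.
Variables (R : realType) (V W : vectType R).

Definition transport (f : {linear W -> V}) (g : {linear V -> W})
  (mul : {bilinear V -> V -> V}) (x y : W) : W := g (mul (f x) (f y)).

Lemma transport_bilinear f g mul :
  bilinear_for *:%R *:%R (transport f g mul).
Proof.
by split=> [y a x1 x2|x a y1 y2];
  rewrite /transport !linearP ?linearPl ?linearP.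
Qed.

HB.instance Definition _ f g mul :=
  bilinear_isBilinear.Build R W W W *:%R *:%R (transport f g mul)
    (transport_bilinear f g mul).

End Transport.

Section Coordinates.
Variables (R : realType) (V : vectType R) (n : nat) (b : n.-tuple V).

Definition lincomb (x : 'rV[R]_n) : V := \sum_i x 0 i *: b`_i.

Lemma lincomb_linear : linear lincomb.
Proof.
move=> a x y; rewrite /lincomb scaler_sumr -big_split; apply: eq_bigr => i _.
by rewrite !mxE scalerDl scalerA.
Qed.

HB.instance Definition _ := GRing.isLinear.Build R _ _ _ lincomb lincomb_linear.

Definition coordrow (v : V) : 'rV[R]_n := \row_i coord b i v.

Lemma coordrow_linear : linear coordrow.
Proof. by move=> a x y; apply/rowP => i; rewrite !mxE linearP. Qed.

HB.instance Definition _ :=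
  GRing.isLinear.Build R _ _ _ coordrow coordrow_linear.

Lemma lincombK U : basis_of U b -> {in U, cancel coordrow lincomb}.
Proof.
move=> bU v vU; rewrite [RHS](coord_basis bU vU).
by apply: eq_bigr => i _; rewrite mxE.
Qed.

Lemma coordrowK U : basis_of U b -> cancel lincomb coordrow.
Proof.
move=> bU x; apply/rowP => i.
by rewrite mxE coord_sum_free // (basis_free bU).
Qed.

Lemma lincomb_mem U x : basis_of U b -> lincomb x \in U.
Proof.
move=> bU; apply: memv_suml => i _; apply: memvZ.
by apply: (basis_mem bU); rewrite mem_nth ?size_tuple.
Qed.

End Coordinates.

Definition no_zero_divisors (R : realType) (V : vectType R)
    (mul : V -> V -> V) : Prop :=
  forall x y, mul x y = 0 -> x = 0 \/ y = 0.

Section VectorIdentities.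
Variables (R : realType) (V : vectType R).

(** Coordinates turn linear identities between vectors into scalar ones that [ring] decides; see
    [vring]. *)
Definition vcoord (i : 'I_(\dim {:V})) (v : V) : R := coord (vbasis fullv) i v.

Lemma vcoordD i u v : vcoord i (u + v) = vcoord i u + vcoord i v.
Proof. exact: linearD. Qed.
Lemma vcoordN i u : vcoord i (- u) = - vcoord i u.
Proof. exact: linearN. Qed.
Lemma vcoordZ i a u : vcoord i (a *: u) = a * vcoord i u.
Proof. exact: linearZ. Qed.
Lemma vcoord0 i : vcoord i 0 = 0.
Proof. exact: linear0. Qed.

Definition vcoordE := (vcoordD, vcoordN, vcoordZ, vcoord0).

Lemma vcoord_ext (u v : V) : (forall i, vcoord i u = vcoord i v) -> u = v.
Proof.
move=> uv; rewrite (coord_vbasis (memvf u)) (coord_vbasis (memvf v)).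
by apply: eq_bigr => i _; have := uv i; rewrite /vcoord => ->.
Qed.

End VectorIdentities.

Ltac vring := apply: vcoord_ext => ?; rewrite ?vcoordE; ring.

Section Algebra.
Variables (R : realType) (V : vectType R).
Implicit Types (mul : {bilinear V -> V -> V}) (U : {vspace V}).

Lemma division_no_zero_divisors mul :
  division_algebra mul -> no_zero_divisors mul.
Proof.
move=> div x y xy; have [->|x0] := eqVneq x 0; [by left | right].
by have [/bij_inj inj _] := div x x0; apply: inj; rewrite bil0r.
Qed.

Lemma commutative_subalgebra_dim mul U :
  no_zero_divisors mul -> subalgebra mul U ->
  {in U &, forall x y, mul x y = mul y x} -> (\dim U <= 2)%N.
Proof.
move=> nz sU cU; rewrite leqNgt; apply/negP => dU.
have [n Un] : exists n, \dim U = n.+3.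
  by exists (\dim U - 3)%N; rewrite -addn3 subnK.
move: (vbasis U) (vbasisP U); rewrite Un => b bU.
apply: (@no_commutative_division_rV R n
  (transport (lincomb b) (coordrow b) mul)).
  by move=> x y; rewrite /= /transport cU // (lincomb_mem _ bU).
move=> x y /(congr1 (lincomb b)); rewrite linear0 /transport.
rewrite (lincombK bU); last by apply: sU; exact: lincomb_mem.
by case/nz => /(congr1 (coordrow b)); rewrite linear0 (coordrowK bU);
  [left | right].
Qed.

(** A subspace is needed in order to speak of dimension. Intersecting with subalgebras that contain
    [a] lowers the dimension until [U] lies in all of them; the converse inclusion is the definition
    of [generated]. *)
Lemma generated_vspace mul a : exists U,
  [/\ subalgebra mul U, a \in U & forall x, x \in U -> generated mul a x].
Proof.
suff H n U : (\dim U <= n)%N -> subalgebra mul U -> a \in U -> exists U,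
    [/\ subalgebra mul U, a \in U & forall x, x \in U -> generated mul a x].
  by apply: (H _ fullv (leqnn _)) => [x y _ _|]; exact: memvf.
elim: n U => [|n IH] U dU sU aU.
  exists U; split=> // x xU W _ _; move: dU xU.
  by rewrite leqn0 dimv_eq0 => /eqP ->; rewrite memv0 => /eqP ->; exact: mem0v.
have [h|] := pselect (forall W, subalgebra mul W -> a \in W -> (U <= W)%VS).
  by exists U; split=> // x xU W sW aW; apply: (subvP (h W sW aW)).
move=> /existsNP[W /not_implyP[sW /not_implyP[aW /negP UW]]].
apply: (IH (U :&: W)%VS).
- rewrite -ltnS; apply: leq_trans dU.
  rewrite ltn_neqAle dimvS ?capvSl // andbT.
  apply: contra UW => /eqP d; apply/capv_idPl/eqP.
  by rewrite -(geq_leqif (dimv_leqif_eq (capvSl U W))) d.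
- by move=> x y /memv_capP[xU xW] /memv_capP[yU yW]; rewrite memv_cap sU ?sW.
- by rewrite memv_cap aU.
Qed.

Lemma mem_span2 (a b v : V) :
  v \in <<[:: a; b]>>%VS <-> exists s t, v = s *: a + t *: b.
Proof.
rewrite span_cons span_seq1; split=> [|[s [t ->]]].
  move=> /memv_addP[_ /vlineP[s ->] [_ /vlineP[t ->] ->]].
  by exists s, t.
by rewrite memv_add // memvZ // memv_line.
Qed.

Lemma mem_span2_swap (a b v : V) :
  v \in <<[:: a; b]>>%VS -> v \notin <[a]>%VS -> b \in <<[:: a; v]>>%VS.
Proof.
move=> /mem_span2[s [t ->]] vb; apply/mem_span2; exists (- s / t), t^-1.
have t0 : t != 0.
  by apply: contraNneq vb => ->; rewrite scale0r addr0 memvZ // memv_line.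
by rewrite scalerDr !scalerA mulVf //; vring.
Qed.

(* If [x^2 = a x] and [y^2 = b y], comparing [(x + y)^2] with [(x - y)^2] gives
   [x y + y x = b x + a y], so that [b x - a y] squares to zero. *)
Lemma sqr_not_all_proportional mul x y : no_zero_divisors mul ->
    (forall s t, s *: x + t *: y = 0 -> s = 0 /\ t = 0) ->
  ~ (forall s t, exists c,
      mul (s *: x + t *: y) (s *: x + t *: y) = c *: (s *: x + t *: y)).
Proof.
move=> nz free_xy H.
have [a] := H 1 0; rewrite scale0r addr0 !scale1r => xx.
have [b] := H 0 1; rewrite scale0r add0r !scale1r => yy.
have [c] := H 1 1; rewrite !scale1r => cc.
have [d] := H 1 (-1); rewrite scaleN1r !scale1r => dd.
pose w := mul x y + mul y x.
have e1 : a *: x + b *: y + w = c *: x + c *: y.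
  by rewrite -scalerDr -cc !(bilE mul) xx yy /w; vring.
have e2 : a *: x + b *: y - w = d *: x - d *: y.
  by rewrite -scalerBr -dd !(bilE mul) xx yy /w; vring.
have [k1 k2] : 2 * a - c - d = 0 /\ 2 * b - c + d = 0.
  apply: free_xy.
  have -> : (2 * a - c - d) *: x + (2 * b - c + d) *: y =
      (a *: x + b *: y + w) + (a *: x + b *: y - w)
      - (c *: x + c *: y) - (d *: x - d *: y).
    by vring.
  by rewrite e1 e2 addrAC addrK subrr.
have cE : c = a + b by lra.
have wE : w = b *: x + a *: y.
  apply: (addrI (a *: x + b *: y)); rewrite e1 cE !scalerDl addrACA.
  by vring.
have : mul (b *: x - a *: y) (b *: x - a *: y) = 0.
  have -> : mul (b *: x - a *: y) (b *: x - a *: y) =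
      b ^+ 2 *: mul x x + a ^+ 2 *: mul y y - (a * b) *: w.
    by rewrite !(bilE mul) /w; vring.
  by rewrite wE xx yy; vring.
move=> /nz z.
have [b0 a0] : b = 0 /\ - a = 0.
  by apply: free_xy; rewrite scaleNr; case: z.
have : mul x x = 0 by rewrite xx -[a]opprK a0 oppr0 scale0r.
move=> /nz x0.
have [] : (1 : R) = 0 /\ (0 : R) = 0.
  by apply: free_xy; rewrite scale1r scale0r addr0; case: x0.
by move/eqP; rewrite oner_eq0.
Qed.

End Algebra.

(** * Quadratic algebras and planar maps *)

Section SpansAndIsotopes.
Variables (R : realType) (V : vectType R).
Implicit Types (mul : {bilinear V -> V -> V}) (U : {vspace V}) (T : 'End(V)).

Lemma mem_span2l (a b : V) : a \in <<[:: a; b]>>%VS.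
Proof. by apply: memv_span; rewrite inE eqxx. Qed.

Lemma mem_span2r (a b : V) : b \in <<[:: a; b]>>%VS.
Proof. by apply: memv_span; rewrite !inE eqxx orbT. Qed.

Lemma span2_sub (a b : V) U : a \in U -> b \in U -> (<<[:: a; b]>> <= U)%VS.
Proof.
by move=> aU bU; apply/span_subvP => v; rewrite !inE => /orP[] /eqP ->.
Qed.

Lemma free3E (a b c : V) :
  free [:: a; b; c] =
  [&& c \notin <<[:: a; b]>>%VS, b \notin <[a]>%VS & a != 0].
Proof.
rewrite (perm_free (permEl (perm_catC [:: a; b] [:: c]))) /= free_cons.
rewrite (perm_free (permEl (perm_catC [:: a] [:: b]))) /= free_cons.
by rewrite span_seq1 seq1_free.
Qed.

Lemma division_isotope mul T :
  division_algebra mul -> bijective T -> division_algebra (isotope mul T).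
Proof.
move=> div bT a a0.
have Ta : T a != 0.
  by apply: contraNneq a0 => Ta; apply/eqP/(bij_inj bT); rewrite Ta linear0.
have [l r] := div _ Ta.
by split; [exact: (bij_comp l bT) | exact: (bij_comp r bT)].
Qed.

Section Quadratic.
Variables (mul : {bilinear V -> V -> V}) (one : V).
Hypotheses (quad : quadratic mul one) (nz : no_zero_divisors mul).

Lemma mul_one_l x : mul one x = x. Proof. by case: quad => -[]. Qed.
Lemma mul_one_r x : mul x one = x. Proof. by case: quad => -[]. Qed.

Lemma quadratic_sqr x : exists s t, mul x x = s *: x + t *: one.
Proof.
have [/vlineP[k ->]|x1] := boolP (x \in <[one]>%VS).
  by exists 0, (k ^+ 2); rewrite !(bilE mul) mul_one_l scale0r add0r scalerA.
have [one0|one0] := eqVneq one 0.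
  by exists 0, 0; rewrite -[x]mul_one_l one0 !bil0l !scaler0 addr0.
have := quad.2 x; rewrite free3E x1 one0 !andbT negbK => /mem_span2[s [t ->]].
by exists t, s; rewrite addrC.
Qed.

(** Write [mul x x = s *: x + t *: one]. If [t != 0], solve for [one]; if [t = 0], then
    [mul x (x - s *: one) = 0] makes [x] a non-zero scalar. *)
Lemma subalgebra_one U x : subalgebra mul U -> x \in U -> x != 0 -> one \in U.
Proof.
move=> sU xU x0; have [s [t xx]] := quadratic_sqr x.
have [t0|t0] := eqVneq t 0.
  have : mul x (x - s *: one) = 0.
    by rewrite !(bilE mul) !mul_one_r xx t0; vring.
  case/nz => [/eqP|/eqP]; first by rewrite (negPf x0).
  rewrite subr_eq0 => /eqP xs.
  have s0 : s != 0 by apply: contraNneq x0 => s0; rewrite xs s0 scale0r.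
  by move: xU; rewrite xs rpredZeq (negPf s0).
rewrite -[one]scale1r -(mulVf t0) -scalerA memvZ //.
have -> : t *: one = mul x x - s *: x by rewrite xx; vring.
by rewrite memvB ?sU // memvZ.
Qed.

Lemma span1_subalgebra x : subalgebra mul <<[:: one; x]>>%VS.
Proof.
move=> u v /mem_span2[a [b ->]] /mem_span2[c [d ->]].
have [s [t xx]] := quadratic_sqr x.
apply/mem_span2; exists (a * c + b * d * t), (a * d + b * c + b * d * s).
by rewrite !(bilE mul) !mul_one_r !mul_one_l xx; vring.
Qed.

Lemma span1_comm x : {in <<[:: one; x]>>%VS &, forall u v, mul u v = mul v u}.
Proof.
move=> u v /mem_span2[a [b ->]] /mem_span2[c [d ->]].
by rewrite !(bilE mul) !mul_one_r !mul_one_l; vring.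
Qed.

(* Completing the square, each non-scalar element is, up to scaling and adding
   a scalar, a square root of [- one]. *)
Lemma imaginary_unit x : x \notin <[one]>%VS ->
  exists a b y, [/\ x = a *: one + b *: y, b != 0 & mul y y = - one].
Proof.
move=> x1; have [s [t xx]] := quadratic_sqr x.
pose m := t + s ^+ 2 / 4.
have [y yE] : exists y, y = x - (s / 2) *: one by eexists.
have yy : mul y y = m *: one.
  by rewrite yE !(bilE mul) !mul_one_r !mul_one_l xx /m; apply: vcoord_ext => ?;
    rewrite ?vcoordE; field.
(* For [m >= 0] the element [mul y y - m *: one] factors, so [y] and hence [x] would be scalar. Thus
   [m < 0], and [y] can be normalised. *)
have [m0|m0] := leP 0 m.
  have : mul (y - Num.sqrt m *: one) (y + Num.sqrt m *: one) = 0.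
    rewrite !(bilE mul) !mul_one_r !mul_one_l yy -{1}(sqr_sqrtr m0); vring.
  have H k : y = k *: one -> False.
    move=> yk; case/negP: x1; have -> : x = (k + s / 2) *: one.
      by rewrite scalerDl -yk yE subrK.
    by rewrite memvZ // memv_line.
  case/nz => /eqP; rewrite ?subr_eq0 ?addr_eq0 => /eqP e.
    by case: (H _ e).
  by case: (H (- Num.sqrt m)); rewrite scaleNr.
have b0 : Num.sqrt (- m) != 0 by rewrite gt_eqF // sqrtr_gt0 oppr_gt0.
exists (s / 2), (Num.sqrt (- m)), ((Num.sqrt (- m))^-1 *: y); split=> //.
  by rewrite scalerA mulfV // scale1r yE addrC subrK.
rewrite !(bilE mul) yy !scalerA -invfM -expr2 sqr_sqrtr ?oppr_ge0 ?ltW //.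
by rewrite invrN mulNr mulVf ?lt_eqF // scaleN1r.
Qed.

(** For non-scalar [z], the imaginary units [y] and [w] of [x] and [z] also commute, so
    [mul (y - w) (y + w) = 0] and [w] is [y] or [- y]. *)
Lemma centralizer_sub x z : x \notin <[one]>%VS -> mul x z = mul z x ->
  z \in <<[:: one; x]>>%VS.
Proof.
move=> x1 xz; have [/vlineP[k ->]|z1] := boolP (z \in <[one]>%VS).
  by rewrite memvZ // mem_span2l.
have [a [b [y [xE b0 yy]]]] := imaginary_unit x1.
have [c [d [w [zE d0 ww]]]] := imaginary_unit z1.
have yE : y = b^-1 *: (x - a *: one).
  by rewrite xE addrC addKr scalerA mulVf // scale1r.
have wE : w = d^-1 *: (z - c *: one).
  by rewrite zE addrC addKr scalerA mulVf // scale1r.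
have yw : mul y w = mul w y.
  rewrite yE wE !(bilE mul) !mul_one_r !mul_one_l xz.
  by vring.
have : mul (y - w) (y + w) = 0 by rewrite -subr_sqr_comm // yy ww subrr.
have yP : y \in <<[:: one; x]>>%VS.
  by rewrite yE memvZ // memvB ?mem_span2r // memvZ // mem_span2l.
rewrite zE; case/nz => /eqP; rewrite ?subr_eq0 ?addr_eq0 => /eqP e.
  by rewrite -e memvD // memvZ // mem_span2l.
by rewrite memvD // memvZ ?mem_span2l // -[w]opprK memvN -e.
Qed.

Lemma planar_span T x : planar mul one T -> T x \in <<[:: one; x]>>%VS.
Proof.
move=> [_ _ h]; apply: (subvP (h _ (@span1_subalgebra x))).
by apply: memv_img; exact: mem_span2r.
Qed.

Lemma planar_of_span T : bijective T -> T one = one ->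
  (forall x, T x \in <<[:: one; x]>>%VS) -> planar mul one T.
Proof.
move=> bT T1 Tx; split=> // U sU; apply/subvP => _ /memv_imgP[x xU ->].
have [->|x0] := eqVneq x 0; first by rewrite linear0 mem0v.
by apply: (subvP (span2_sub (subalgebra_one sU xU x0) xU)).
Qed.

Section PlanarMultiple.
Variables (S T : 'End(V)) (lam : R).
Hypotheses (pS : planar mul one S) (TE : T = lam *: S).

Lemma planar_multiple_span x y :
  y \in <<[:: one; x]>>%VS -> T y \in <<[:: one; x]>>%VS.
Proof.
move=> yx; rewrite TE lfunE /= memvZ //.
by apply: subvP (planar_span y pS); rewrite span2_sub // mem_span2l.
Qed.

Lemma planar_multiple_power_commutative : power_commutative (isotope mul T).
Proof.
move=> a x y gx gy.
have sP : subalgebra (isotope mul T) <<[:: one; a]>>%VS.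
  by move=> u v ? ?; apply: span1_subalgebra; exact: planar_multiple_span.
have aP := mem_span2r one a.
by apply: (@span1_comm a); apply: planar_multiple_span;
  [exact: gx | exact: gy].
Qed.

(** The square of [u] in the isotope lies in the span of [one] and [u]. If [one] were outside [U],
    its coefficient would vanish for all [u] in [U], and squares would be proportional throughout a
    plane. *)
Lemma planar_multiple_one_mem U : no_zero_divisors (isotope mul T) ->
  subalgebra (isotope mul T) U -> \dim U = 2%N -> one \in U.
Proof.
move=> nzT sU dU; apply/negPn/negP => oneU.
move: (vbasis U) (vbasisP U); rewrite dU => b bU.
have bi i : (i < 2)%N -> b`_i \in U.
  by move=> i2; rewrite (basis_mem bU) // mem_nth // size_tuple.
have fb := basis_free bU.
apply: (@sqr_not_all_proportional R V (isotope mul T) b`_0 b`_1 nzT).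
  move=> s t st0; have /freeP/(_ (fun i => if i == 0 then s else t)) := fb.
  rewrite big_ord_recl big_ord1 /= => /(_ st0) h.
  by split; [have := h 0 | have := h (lift ord0 ord0)].
move=> s t; set u := _ + _.
have uU : u \in U by rewrite memvD // memvZ // bi.
have [p [q e]] : exists p q, isotope mul T u u = p *: one + q *: u.
  apply/mem_span2; apply: span1_subalgebra;
    by apply: planar_multiple_span; exact: mem_span2r.
exists q; suff p0 : p = 0 by rewrite [LHS]e p0 scale0r add0r.
apply/eqP; apply: contraNT oneU => p0.
have : p *: one \in U.
  have -> : p *: one = isotope mul T u u - q *: u by rewrite e addrK.
  by rewrite memvB ?sU // memvZ.
by rewrite rpredZeq (negPf p0).
Qed.

End PlanarMultiple.

End Quadratic.

End SpansAndIsotopes.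

(** * Power-commutative isotopes *)

Section PowerCommutativeIsotope.
Variables (R : realType) (V : vectType R) (mul : {bilinear V -> V -> V}).
Variables (one : V) (T : 'End(V)).
Hypotheses (quad : quadratic mul one) (div : division_algebra mul).
Hypotheses (dimV : (3 <= \dim {:V})%N) (bT : bijective T).
Hypothesis pc : power_commutative (isotope mul T).

Let nz := division_no_zero_divisors div.

Lemma not_mem_span2 (a b : V) : exists v, v \notin <<[:: a; b]>>%VS.
Proof.
apply/not_existsP => h; have : (\dim <<[:: a; b]>> <= 2)%N.
  by rewrite (leq_trans (dim_span _)).
rewrite leqNgt => /negP; apply; apply: leq_trans dimV _; apply: dimvS.
by apply/subvP => v _; apply/negPn/negP; exact: h.
Qed.

Lemma one_neq0 : one != 0.
Proof.
have [v] := not_mem_span2 0 0; apply: contraNneq => one0.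
by rewrite -(mul_one_l quad v) one0 bil0l mem0v.
Qed.

Lemma comm_image_sqr y : mul y (T (mul y y)) = mul (T (mul y y)) y.
Proof.
have [T' T'K TK'] := bT; have := pc (a := T' y) (x := T' y)
  (y := isotope mul T (T' y) (T' y)).
rewrite /= /isotope TK'; apply; first by move=> U _.
by move=> U sU yU; have := sU _ _ yU yU; rewrite /= /isotope TK'.
Qed.

(** Otherwise take [v] outside the span of [one] and [T one], with imaginary unit [y]. From
    [mul y y = - one], [y] commutes with [T one], so [T one] is in the span of [one] and [y];
    exchanging the two puts [y], hence [v], in the excluded plane. *)
Lemma image_one_scalar : T one \in <[one]>%VS.
Proof.
apply/negPn/negP => T1.
have [v v1] := not_mem_span2 one (T one).
have v0 : v \notin <[one]>%VS.
  by apply: contraNN v1 => /vlineP[k ->]; rewrite memvZ // mem_span2l.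
have [a [b [y [vE b0 yy]]]] := imaginary_unit quad nz v0.
have y0 : y \notin <[one]>%VS.
  by apply: contraNN v0 => y1; rewrite vE memvD // memvZ // memv_line.
have := comm_image_sqr y; rewrite yy linearN bilNr bilNl => /oppr_inj Ty.
have Ty1 := centralizer_sub quad nz y0 Ty.
case/negP: v1; rewrite vE memvD // memvZ ?mem_span2l //.
exact: mem_span2_swap Ty1 T1.
Qed.

Lemma image_mem_span x : T x \in <<[:: one; x]>>%VS.
Proof.
have /vlineP[l T1] := image_one_scalar.
have [/vlineP[k ->]|x1] := boolP (x \in <[one]>%VS).
  by rewrite linearZ /= T1 memvZ // memvZ // mem_span2l.
have H y s t : y \notin <[one]>%VS -> mul y y = s *: y + t *: one -> s != 0 ->
    T y \in <<[:: one; y]>>%VS.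
  move=> y1 yy s0; apply: (centralizer_sub quad nz y1).
  have := comm_image_sqr y; rewrite yy linearD !linearZ /= T1.
  rewrite !(bilE mul) (mul_one_l quad) (mul_one_r quad) => /addIr.
  by move/(scalerI s0).
have [s [t xx]] := quadratic_sqr quad x.
have [s0|s0] := eqVneq s 0; last exact: (H _ _ _ x1 xx s0).
(* If [mul x x = t *: one], then [x + one] has the square [2 *: (x + one) + (t - 1) *: one], to
   which [H] applies. *)
have y1 : x + one \notin <[one]>%VS.
  by apply: contraNN x1 => h; rewrite -[x](addrK one) memvB // memv_line.
have : T (x + one) \in <<[:: one; (x + one)%R]>>%VS.
  apply: (H _ 2 (t - 1)) => //; last by rewrite pnatr_eq0.
  by rewrite !(bilE mul) !(mul_one_r quad) (mul_one_l quad) xx s0; vring.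
move=> h; have -> : T x = T (x + one) - l *: one by rewrite linearD /= T1 addrK.
apply: memvB; last by rewrite memvZ // mem_span2l.
by apply: subvP h; rewrite span2_sub ?memvD ?mem_span2l ?mem_span2r.
Qed.

Lemma power_commutative_isotope_planar : exists (S : 'End(V)) (lam : R),
  [/\ planar mul one S, lam != 0 & T = lam *: S].
Proof.
have /vlineP[l T1] := image_one_scalar.
have l0 : l != 0.
  apply/eqP => l0; move: T1; rewrite l0 scale0r -(linear0 T) => /(bij_inj bT).
  by apply/eqP; exact: one_neq0.
exists (l^-1 *: T), l; split=> //; last by rewrite scalerA mulfV // scale1r.
apply: (planar_of_span quad nz).
- have [T' T'K TK'] := bT; exists (fun x => T' (l *: x)) => x; rewrite lfunE /=.
    by rewrite scalerA mulfV // scale1r T'K.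
  by rewrite TK' scalerA mulVf // scale1r.
- by rewrite lfunE /= T1 scalerA mulVf // scale1r.
- by move=> x; rewrite lfunE /= memvZ // image_mem_span.
Qed.

End PowerCommutativeIsotope.

(** * Omnipresent idempotents *)

Section OmnipresentIdempotent.
Variables (R : realType) (V : vectType R) (mul : {bilinear V -> V -> V}).
Variable e : V.
Hypotheses (div : division_algebra mul) (pc : power_commutative mul).
Hypothesis omni : omnipresent_idempotent mul e.

Let nz := division_no_zero_divisors div.
Let e0 : e != 0. Proof. by case: omni. Qed.
Let ee : mul e e = e. Proof. by case: omni. Qed.

Lemma sqr_proportional_or_plane x : (exists c, mul x x = c *: x) \/
  exists U, [/\ subalgebra mul U, \dim U = 2%N, e \in U, x \in U &
               {in U &, forall u v, mul u v = mul v u}].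
Proof.
have [U [sU xU gU]] := generated_vspace mul x.
have cU : {in U &, forall u v, mul u v = mul v u}.
  by move=> u v uU vU; apply: pc (gU _ uU) (gU _ vU).
have dU := commutative_subalgebra_dim nz sU cU.
have [d2|d2] := eqVneq (\dim U) 2%N.
  by right; exists U; split=> //; case: omni => _ _; apply.
left; have d1 : (\dim U <= 1)%N by case: (\dim U) dU d2 => [|[|[]]].
have [->|x0] := eqVneq x 0; first by exists 0; rewrite bil0l scaler0.
apply/vlineP; have <- : U = <[x]>%VS.
  by apply/eqP; rewrite eq_sym eqEdim -memvE xU dim_vline x0.
exact: sU.
Qed.

(** If [x] does not commute with [e], neither does [s *: x + t *: e] for [s != 0]. No such element
    lies in a commutative plane through [e], so squares are proportional on the whole span of [x]
    and [e]. *)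
Lemma comm_e x : mul e x = mul x e.
Proof.
apply/eqP/negPn/negP => /eqP nc.
have nc' s t : s != 0 -> mul e (s *: x + t *: e) <> mul (s *: x + t *: e) e.
  by move=> s0; rewrite !(bilE mul) => /addIr/(scalerI s0).
apply: (@sqr_not_all_proportional R V mul x e nz) => [s t st0|s t].
  have s0 : s = 0.
    by apply/eqP/negPn/negP => /(nc' _ t); rewrite st0 bil0l bil0r.
  split=> //; move: st0; rewrite s0 scale0r add0r => /eqP.
  by rewrite scaler_eq0 (negPf e0) orbF => /eqP.
have [->|s0] := eqVneq s 0.
  by exists t; rewrite scale0r add0r !(bilE mul) ee.
have [//|[U [_ _ eU xU cU]]] := sqr_proportional_or_plane (s *: x + t *: e).
by case: (nc' _ t s0); exact: cU.
Qed.

(** If [x] or [x + e] lies in a plane subalgebra through [e], that plane is the span. Otherwise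
    [mul x x = c *: x] and the square of [x + e] is [d *: (x + e)]; expanding the latter yields
    [mul e x]. *)
Lemma span_e_subalgebra x : subalgebra mul <<[:: e; x]>>%VS.
Proof.
suff [ex xx] : mul e x \in <<[:: e; x]>>%VS /\ mul x x \in <<[:: e; x]>>%VS.
  move=> u v /mem_span2[a [b ->]] /mem_span2[c [d ->]].
  by rewrite !(bilE mul) -(comm_e x) ee !(memvD, memvZ) ?mem_span2l.
have [/vlineP[k ->]|xe] := boolP (x \in <[e]>%VS).
  by rewrite !(bilE mul) ee !memvZ // mem_span2l.
have plane U : subalgebra mul U -> \dim U = 2%N -> e \in U -> x \in U ->
    mul e x \in <<[:: e; x]>>%VS /\ mul x x \in <<[:: e; x]>>%VS.
  move=> sU dU eU xU; have <- : U = <<[:: e; x]>>%VS.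
    apply/eqP; rewrite eq_sym eqEdim span2_sub // dU.
    have : free [:: x; e].
      by rewrite free_cons span_seq1 xe seq1_free.
    rewrite (perm_free (permEl (perm_catC [:: x] [:: e]))) /= => /eqP ->.
    by [].
  by split; exact: sU.
have [[c xx]|[U [? ? ? ? _]]] := sqr_proportional_or_plane x;
  last exact: (plane U).
have [[d yy]|[U [? ? eU yU _]]] := sqr_proportional_or_plane (x + e);
  last first.
  by apply: (plane U) => //; rewrite -[x](addrK e) memvB.
split; last by rewrite xx memvZ // mem_span2r.
have -> : mul e x = ((d - c) / 2) *: x + ((d - 1) / 2) *: e.
  have -> : ((d - c) / 2) *: x + ((d - 1) / 2) *: e =
     2^-1 *: (d *: (x + e) - c *: x - e) by vring.
  by rewrite -yy !(bilE mul) xx ee -(comm_e x); apply: vcoord_ext => ?;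
    rewrite ?vcoordE; field.
by rewrite memvD // memvZ ?mem_span2l // mem_span2r.
Qed.

Lemma omnipresent_planar_isotope :
  exists (mulB : {bilinear V -> V -> V}) (one : V) (T : 'End(V)),
    [/\ quadratic mulB one, division_algebra mulB, planar mulB one T &
        forall x y : V, mul x y = isotope mulB T x y].
Proof.
pose T : 'End(V) := linfun (mul e).
have TE x : T x = mul e x by rewrite lfunE.
have kT : lker T == 0%VS.
  by apply/lker0P => x y; rewrite !TE; apply: bij_inj; case: (div e0).
pose S : 'End(V) := (T^-1)%VF.
have SK : cancel T S by exact: lker0_lfunK.
have KS : cancel S T by exact: lker0_lfunVK.
have Te : T e = e by rewrite TE ee.
have Se : S e = e by rewrite -[in S e]Te SK.
have bT : bijective T by exists S.
have bS : bijective S by exists T.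
have Tspan x : T x \in <<[:: e; x]>>%VS.
  by rewrite TE; apply: span_e_subalgebra; rewrite ?mem_span2l ?mem_span2r.
(* The injective [T] maps this finite-dimensional span into itself, hence onto itself. *)
have Sspan x : S x \in <<[:: e; x]>>%VS.
  have : (T @: <<[:: e; x]>> == <<[:: e; x]>>)%VS.
    rewrite eqEdim limg_dim_eq ?leqnn ?andbT; last first.
      by rewrite (eqP kT) capv0.
    apply/subvP => _ /memv_imgP[y yx ->]; apply: subvP (Tspan y).
    by rewrite span2_sub // mem_span2l.
  move=> /eqP TP; have : x \in (T @: <<[:: e; x]>>)%VS by rewrite TP mem_span2r.
  by case/memv_imgP => y yP xE; rewrite {1}xE SK.
(* Since [S e = e], the new product of [e] and [x] is [mul e (S x) = T (S x) = x]. *)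
have id_e : identity_element (isotope mul S) e.
  by split=> x; rewrite /= /isotope Se ?[mul (S x) e]/= -?comm_e -TE KS.
have quadB : quadratic (isotope mul S) e.
  split=> // x; rewrite free3E negb_and negbK; apply/orP; left.
  by apply: span_e_subalgebra; exact: Sspan.
have divB : division_algebra (isotope mul S) by exact: division_isotope.
exists (isotope mul S), e, T; split=> //.
  exact: (planar_of_span quadB (division_no_zero_divisors divB)).
by move=> x y; rewrite /isotope /= /isotope !SK.
Qed.

End OmnipresentIdempotent.

(** As [T one = lam *: one], the square of [one] in the isotope is [lam ^+ 2 *: one]. The
    omnipresent idempotent on this line is therefore [lam ^- 2 *: one], which equals [one] exactly
    when [lam ^+ 2 = 1]. *)
Theorem theorem8 (R : realType) :
  (forall (V : vectType R) (mul : {bilinear V -> V -> V}) (one : V)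
          (T : 'End(V)),
      quadratic mul one -> division_algebra mul -> (4 <= \dim {:V})%N ->
      bijective T ->
      (power_commutative (isotope mul T) <->
         exists (S : 'End(V)) (lam : R),
           [/\ planar mul one S, lam != 0 & T = lam *: S])
      /\
      (forall (S : 'End(V)) (lam : R),
         planar mul one S -> lam != 0 -> T = lam *: S ->
         omnipresent_idempotent (isotope mul T) (lam ^- 2 *: one)
         /\ (omnipresent_idempotent (isotope mul T) one <-> lam ^+ 2 = 1)))
  /\
  (forall (V : vectType R) (mul : {bilinear V -> V -> V}),
      division_algebra mul -> power_commutative mul ->
      (exists e : V, omnipresent_idempotent mul e) ->
      exists (mulB : {bilinear V -> V -> V}) (one : V) (T : 'End(V)),
        [/\ quadratic mulB one, division_algebra mulB, planar mulB one T &
            forall x y : V, mul x y = isotope mulB T x y]).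
Proof.
split=> [V mul one T quad div dimV bT|V mul div pc [e]]; last first.
  exact: omnipresent_planar_isotope.
have dimV3 : (3 <= \dim {:V})%N by exact: ltnW.
have one0 := one_neq0 quad dimV3.
split.
  split=> [|[S [lam [pS lam0 TE]]]].
    exact: power_commutative_isotope_planar.
  exact: (planar_multiple_power_commutative quad pS TE).
move=> S lam pS lam0 TE.
have T1 : T one = lam *: one by case: pS => _ S1 _; rewrite TE lfunE /= S1.
have omni : omnipresent_idempotent (isotope mul T) (lam ^- 2 *: one).
  split.
  - by rewrite scaler_eq0 invr_eq0 expf_eq0 (negPf lam0).
  - rewrite /= /isotope linearZ /= T1 !(bilE mul) (mul_one_l quad) !scalerA.
    by congr (_ *: _); field.
  - move=> U sU dU; rewrite memvZ //.
    have nzT := division_no_zero_divisors (division_isotope div bT).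
    exact: (planar_multiple_one_mem quad pS TE nzT sU dU).
split=> //; split=> [[_ + _]|lam2]; last by rewrite lam2 invr1 scale1r in omni.
rewrite /= /isotope T1 !(bilE mul) (mul_one_l quad) scalerA -expr2 => /eqP.
by rewrite -subr_eq0 -[X in _ - X]scale1r -scalerBl scaler_eq0 (negPf one0) orbF
  subr_eq0 => /eqP.
Qed.
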